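(* Assume $\gcd(p,q)=1$, fix $a\in\mathcal A_{\mathrm{cyc}}$, and let $\mathcal L_{(a)}(\boldsymbol t)=\mathcal S^q+c^{(a)}(\boldsymbol t)\mathcal S^{-p}$ be the solution, selected by the positive bidiagonal factorization, of the Lax equations $\partial_{t_\ell}\mathcal L=[(\mathcal L^{M\ell})_+,\mathcal L]$, $\ell\ge1$, with initial operator $\mathcal S^q+c^{(a)}\mathcal S^{-p}$; let $\mathscr H_{(a)}(\boldsymbol t)$ be its semi-infinite matrix, with factors $\widetilde F_r^{(a)}(\boldsymbol t)$ and cyclic products $\widetilde T_{(a;r)}(\boldsymbol t)$. Then every cyclic block satisfies \[ \frac{\partial\widetilde T_{(a;r)}}{\partial t_\ell}=\bigl[(\widetilde T_{(a;r)}^{\,\ell})_+,\widetilde T_{(a;r)}\bigr],\qquad r\in\{1,\dots,M\}. \] The factors connecting consecutive blocks satisfy the auxiliary equations \[ \frac{\partial\widetilde F_r^{(a)}}{\partial t_\ell}=(\widetilde T_{(a;r)}^{\,\ell})_+\widetilde F_r^{(a)}-\widetilde F_r^{(a)}(\widetilde T_{(a;r+1)}^{\,\ell})_+ , \] where the indices are read cyclically and the orientation is fixed by $\widetilde T_{(a;r)}\widetilde F_r^{(a)}=\widetilde F_r^{(a)}\widetilde T_{(a;r+1)}$. Thus the semi-infinite matrix $\mathscr H_{(a)}(\boldsymbol t)$ of $\mathcal L_{(a)}(\boldsymbol t)$ is a common integrable $M$-th root of the cyclic Toda family: in factor-copy order, $\mathscr H_{(a)}(\boldsymbol t)^M$ is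 $\operatorname{diag}\bigl(\widetilde T_{(a;1)},\dots,\widetilde T_{(a;M)}\bigr)$. If, in addition, the factor-copy polynomial arrays are taken in Sato-compatible Gauss--Borel normalizations, so that the off-diagonal blocks $\widetilde F_r^{(a)}$ are the corresponding Christoffel connections, then the factor transfers are discrete B\''acklund directions, and the auxiliary equation is precisely the continuous--discrete Christoffel compatibility equation $\partial_{t_\ell}F=(T_1^\ell)_+F-F(T_0^\ell)_+$ with $F=\widetilde F_r^{(a)}$, $T_1=\widetilde T_{(a;r)}$, $T_0=\widetilde T_{(a;r+1)}$. Under other time-dependent initial-condition gauges, the compatibility is gauge-covariant and contains the corresponding gauge terms.
   Context: Let $p,q\ge1$ be coprime, $M=p+q$. Matrices are semi-infinite, indexed by $\mathbb N_0$. A lower bidiagonal $L$ is normalized if $L_{n,n}=1$, an upper bidiagonal $U$ is normalized if $U_{n,n+1}=1$; positive means that the remaining bidiagonal entries are all $>0$. Let $T=L_1\cdots L_pU_q\cdots U_1$ with all factors normalized positive (a positive bidiagonal factorization); $F_k=L_k$ ($1\le k\le p$), $F_{p+b}=U_{q-b+1}$ ($1\le b\le q$). $\mathcal A_{\mathrm{cyc}}=\{a_-,\dots,a_+\}$, $a_-=p-\lceil p/q\rceil+1$, $a_+=p+1+\min\{q-1,\lceil q/p\rceil\}$. Let $r_k$ be the remainder of $kq$ mod $M$, and $\sigma_{\mathrm{min}}$ the word of length $M$ whose $(k+1)$-st letter is $L$ if $r_k<p$ and $U$ otherwise. For $a\in\mathcal A_{\mathrm{cyc}}$, finitely many replacements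 of a neighbouring pair $U,L$ (upper before lower) by the unique normalized positive pair $\widetilde L,\widetilde U$ with $UL=\widetilde L\widetilde U$ transform $(F_a,\dots,F_M,F_1,\dots,F_{a-1})$ into a list $(\widetilde F^{(a)}_1,\dots,\widetilde F^{(a)}_M)$ of normalized positive bidiagonal factors with type word $\sigma_{\mathrm{min}}$ (independent of choices). Correspondence between coefficients and factors: each height $h\in\mathbb N_0$ is written uniquely as $h=Mn+r_{j-1}$ with $n\in\mathbb N_0$, $j\in\{1,\dots,M\}$; this gives the fixed permutation between factor-copy order, labelled by $(j,n)$, and height order. One sets $c_h^{(a)}=(\widetilde F^{(a)}_j)_{n,n-1}$ if the $j$-th letter of $\sigma_{\mathrm{min}}$ is $L$ (and $n\ge1$), $c_h^{(a)}=(\widetilde F^{(a)}_j)_{n,n}$ if it is $U$; $c_h^{(a)}=0$ for $h<p$. The semi-infinite matrix of $\mathcal S^q+c\,\mathcal S^{-p}$ has entries $1$ at $(h,h+q)$, $c_h$ at $(h,h-p)$ ($h\ge p$), and zeros elsewhere. For the time-dependent sequence $c^{(a)}(\boldsymbol t)$ the same correspondence defines normalized bidiagonal factors $\widetilde F_r^{(a)}(\boldsymbol t)$, equivalently the cyclic off-diagonal blocks, in positions $(r,r+1)$ read modulo $M$, of $\mathscr H_{(a)}(\boldsymbol t)$ in factor-copy order; and $\widetilde T_{(a;r)}=\widetilde F_r^{(a)}\cdots\widetilde F_M^{(a)}\widetilde F_1^{(a)}\cdots\widetilde F_{r-1}^{(a)}$. $\mathcal S$ is the forward shift, $(\mathcal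 Sf)_h=f_{h+1}$, $\mathcal S^jc=c_{\,\cdot+j}\mathcal S^j$; for difference operators $X_+$ is the part with nonnegative powers of $\mathcal S$; for semi-infinite matrices $X_+$ is the upper triangular part including the diagonal and $X_-=X-X_+$ is the strictly lower triangular part. The solution is the unique coefficientwise formal power-series solution in any fixed finite set of times. Christoffel connections and normalizations: two consecutive mixed-type systems ($j=0,1$), whose $q\times p$ moment functionals are related by a fixed row-side (left) or column-side (right) matrix polynomial multiplication and are both deformed by the scalar factor $\exp(\sum_{k\ge1}t_kx^k)$, have recurrence matrices $T_j(\boldsymbol t)$ and right polynomial arrays $\boldsymbol B_j(x;\boldsymbol t)$, $T_j\boldsymbol B_j=x\boldsymbol B_j$. The normalized bidiagonal connection $F$ satisfies $F\boldsymbol B_0=\boldsymbol B_1\mathsf K(x)$, with $\mathsf K$ a matrix polynomial independent of time. Sato-compatible Gauss--Borel normalization means that $\partial_{t_\ell}\boldsymbol B_j=-(T_j^\ell)_-\boldsymbol B_j$, the normalization being fixed by a constant gauge at $\boldsymbol t=\boldsymbol 0$. An initial-condition gauge is a choice of the nonsingular lower triangular matrix formed by the first $q$ rows of $\boldsymbol B_j$; changing it replaces $\boldsymbol B_j$ by $\boldsymbol B_jC_j$ with $C_j$ a nonsingular lower triangular $q\times q$ matrix not depending on $x$. *)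

(* Defs.v *)
From HB Require Import structures.
From Stdlib Require Import Relation_Operators.
From mathcomp Require Import all_boot all_order all_algebra.
From mathcomp Require Import boolp classical_sets functions cardinality fsbigop.
From mathcomp Require Import mpoly.

Set Implicit Arguments.
Unset Strict Implicit.
Unset Printing Implicit Defensive.

Import Order.TTheory GRing.Theory Num.Theory.
Local Open Scope ring_scope.

(* R[[t_0, ..., t_(N-1)]]: a series is the family of its coefficients, indexed
   by the exponents m : 'X_{1..N}. *)
Record fps (R : Type) (N : nat) := Fps { fps_coef : 'X_{1..N} -> R }.

Section FpsRing.
Variables (R : comNzRingType) (N : nat).
Local Notation K := (fps R N).
Implicit Types f g h : K.

Lemma fps_ext f g : (forall m, fps_coef f m = fps_coef g m) -> f = g.
Proof. by case: f g => [f] [g] /= fg; congr Fps; apply/funext. Qed.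

HB.instance Definition _ := gen_eqMixin K.
HB.instance Definition _ := gen_choiceMixin K.

Definition fpsC (c : R) : K := Fps (fun m => if m == 0%MM then c else 0).
Definition fps_opp f : K := Fps (fun m => - fps_coef f m).
Definition fps_add f g : K := Fps (fun m => fps_coef f m + fps_coef g m).
Definition fps_mul f g : K := Fps (fun m =>
  \sum_(k : 'X_{1..N < (mdeg m).+1, (mdeg m).+1} | m == (k.1 + k.2)%MM)
     fps_coef f k.1 * fps_coef g k.2).

Lemma fps_addA : associative fps_add.
Proof. by move=> f g h; apply: fps_ext => m /=; rewrite addrA. Qed.
Lemma fps_addC : commutative fps_add.
Proof. by move=> f g; apply: fps_ext => m /=; rewrite addrC. Qed.
Lemma fps_add0 : left_id (fpsC 0) fps_add.
Proof. by move=> f; apply: fps_ext => m /=; rewrite if_same add0r. Qed.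
Lemma fps_addN : left_inverse (fpsC 0) fps_opp fps_add.
Proof. by move=> f; apply: fps_ext => m /=; rewrite if_same addNr. Qed.

HB.instance Definition _ :=
  GRing.isZmodule.Build K fps_addA fps_addC fps_add0 fps_addN.

(* Truncation to total degree < d; products of series are computed on it. *)
Definition fps_trunc d f : {mpoly R[N]} :=
  \sum_(m : 'X_{1..N < d}) fps_coef f m *: 'X_[m].

Lemma fps_truncE d f m : (mdeg m < d)%N -> (fps_trunc d f)@_m = fps_coef f m.
Proof. exact: mcoeff_mpoly. Qed.

Lemma mcoeff_mul_low (P P' Q Q' : {mpoly R[N]}) m :
    (forall k, (mdeg k <= mdeg m)%N -> P@_k = P'@_k) ->
    (forall k, (mdeg k <= mdeg m)%N -> Q@_k = Q'@_k) ->
  (P * Q)@_m = (P' * Q')@_m.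
Proof.
move=> PP' QQ'; rewrite !mcoeffM; apply: eq_bigr => k _.
by rewrite PP' ?QQ' // -ltnS; [case: k.2 | case: k.1].
Qed.

Lemma fps_mulE d f g m : (mdeg m < d)%N ->
  fps_coef (fps_mul f g) m = (fps_trunc d f * fps_trunc d g)@_m.
Proof.
move=> md; rewrite mcoeffM /=; apply: eq_bigr => k _.
by rewrite !fps_truncE //; apply: leq_trans md; [case: k.2 | case: k.1].
Qed.

Lemma fps_mulA : associative fps_mul.
Proof.
move=> f g h; apply: fps_ext => m.
rewrite !(@fps_mulE (mdeg m).+1) //.
transitivity ((fps_trunc (mdeg m).+1 f *
   (fps_trunc (mdeg m).+1 g * fps_trunc (mdeg m).+1 h))@_m).
  apply: mcoeff_mul_low => // k km.
  by rewrite fps_truncE ?ltnS // (@fps_mulE (mdeg m).+1) ?ltnS.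
rewrite mulrA; apply: mcoeff_mul_low => // k km.
by rewrite fps_truncE ?ltnS // (@fps_mulE (mdeg m).+1) ?ltnS.
Qed.

Lemma fps_mulC : commutative fps_mul.
Proof.
move=> f g; apply: fps_ext => m.
by rewrite !(@fps_mulE (mdeg m).+1) // mulrC.
Qed.

Lemma fps_mul1 : left_id (fpsC 1) fps_mul.
Proof.
move=> f; apply: fps_ext => m; rewrite (@fps_mulE (mdeg m).+1) //.
rewrite -(@fps_truncE (mdeg m).+1 f m) // -[in RHS](mul1r (fps_trunc _ _)).
apply: mcoeff_mul_low => // k km.
by rewrite fps_truncE ?ltnS //= mcoeff1; case: eqP.
Qed.

Lemma fps_mulDl : left_distributive fps_mul fps_add.
Proof.
move=> f g h; apply: fps_ext => m /=.
by rewrite -big_split; apply: eq_bigr => k _ /=; rewrite mulrDl.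
Qed.

Lemma fps_1neq0 : fpsC 1 != 0.
Proof.
apply/eqP => /(congr1 (fun f : K => fps_coef f 0%MM)) /=.
by rewrite eqxx => /eqP; rewrite oner_eq0.
Qed.

HB.instance Definition _ := GRing.Zmodule_isComNzRing.Build K
  fps_mulA fps_mulC fps_mul1 fps_mulDl fps_1neq0.

Definition fps_unit : pred K := fun f => `[< exists g, g * f = 1 >].
Definition fps_inv f : K :=
  if pselect (exists g, g * f = 1) is left fU then projT1 (cid fU) else f.

Lemma fps_mulV : {in fps_unit, left_inverse 1 fps_inv *%R}.
Proof.
move=> f /asboolP fU; rewrite /fps_inv; case: pselect => // fU'.
by case: cid.
Qed.
Lemma fps_unitP f g : g * f = 1 -> fps_unit f.
Proof. by move=> gf; apply/asboolP; exists g. Qed.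
Lemma fps_inv_out : {in [predC fps_unit], fps_inv =1 id}.
Proof.
by move=> f /asboolPn fNU; rewrite /fps_inv; case: pselect.
Qed.

HB.instance Definition _ :=
  GRing.ComNzRing_hasMulInverse.Build K fps_mulV fps_unitP fps_inv_out.

Definition fps_deriv (i : 'I_N) f : K :=
  Fps (fun m => fps_coef f (m + U_(i))%MM *+ (m i).+1).

End FpsRing.

Arguments fpsC {R N} c.

(* Semi-infinite matrices indexed by nat. The sum in the product is the finitely
   supported sum of fsbigop; all products below have a left factor whose rows
   are finitely supported. *)
Definition smx (K : Type) := nat -> nat -> K.

Section SemiInfinite.
Variable K : comNzRingType.
Implicit Types A B X : smx K.

Definition smx1 : smx K := fun n m => (n == m)%:R.
Definition smul A B : smx K :=
  fun n m => \sum_(k \in [set: nat]) A n k * B k m.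
Definition ssub A B : smx K := fun n m => A n m - B n m.
Definition sexp A l : smx K := iter l (smul A) smx1.
Definition scomm A B : smx K := ssub (smul A B) (smul B A).
Definition sprod (s : seq (smx K)) : smx K := foldr smul smx1 s.
Definition spos A : smx K := fun n m => if (n <= m)%N then A n m else 0.
Definition sneg A : smx K := ssub A (spos A).
Definition row_finite A := forall n, finite_set [set k | A n k != 0].

End SemiInfinite.

Definition sderiv (R : comNzRingType) N (i : 'I_N) (A : smx (fps R N)) :
  smx (fps R N) := fun n m => fps_deriv i (A n m).

Inductive letter := Lo | Up.

Definition normalized (K : comNzRingType) w (A : smx K) : Prop :=
  match w with
  | Lo => (forall n, A n n = 1) /\
          (forall n m, n != m -> n != m.+1 -> A n m = 0)
  | Up => (forall n, A n n.+1 = 1) /\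
          (forall n m, m != n -> m != n.+1 -> A n m = 0)
  end.

Definition normalized_positive (R : realFieldType) w (A : smx R) : Prop :=
  normalized w A /\
  match w with Lo => forall n, 0 < A n.+1 n | Up => forall n, 0 < A n n end.

Inductive swap (R : realFieldType) : seq (smx R) -> seq (smx R) -> Prop :=
  Swap s1 s2 U L L' U' of
      normalized_positive Up U & normalized_positive Lo L
    & normalized_positive Lo L' & normalized_positive Up U'
    & smul U L = smul L' U' :
  swap (s1 ++ [:: U; L] ++ s2) (s1 ++ [:: L'; U'] ++ s2).

Definition swaps (R : realFieldType) := clos_refl_trans _ (@swap R).

(* (F_1, ..., F_M) = (L_1, ..., L_p, U_q, ..., U_1) *)
Definition factor_list (R : realFieldType) (p q : nat) (L U : nat -> smx R) :=
  [seq L k | k <- iota 1 p] ++ [seq U b | b <- rev (iota 1 q)].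

Definition ceil_div (m d : nat) : nat := ((m + d.-1) %/ d)%N.

Definition in_A_cyc (p q a : nat) : bool :=
  (p - ceil_div p q + 1 <= a <= p + 1 + minn q.-1 (ceil_div q p))%N.

(* From here on the indices k, j, r of the words and of the cyclic families
   start at 0: letter_min p q j is the (j+1)-st letter of the word. *)
Definition res (p q k : nat) : nat := (k * q %% (p + q))%N.
Definition letter_min (p q j : nat) : letter :=
  if (res p q j < p)%N then Lo else Up.
Definition sigma_min (p q : nat) : seq letter :=
  mkseq (letter_min p q) (p + q).

Definition has_type_word (R : realFieldType) (w : seq letter)
    (s : seq (smx R)) : Prop :=
  size s = size w /\
  forall j, (j < size w)%N ->
    normalized_positive (nth Lo w j) (nth (@smx1 R) s j).

(* The height of the n-th element of the factor copy j, and the inverse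
   permutation. *)
Definition height (p q j n : nat) : nat := ((p + q) * n + res p q j)%N.
Definition copy_of (p q h : nat) : nat :=
  index (h %% (p + q))%N (mkseq (res p q) (p + q)).

Definition coef_of_factors (R : realFieldType) (p q : nat)
    (s : seq (smx R)) (h : nat) : R :=
  let j := copy_of p q h in
  let n := (h %/ (p + q))%N in
  let A := nth (@smx1 R) s j in
  if (h < p)%N then 0
  else match letter_min p q j with Lo => A n n.-1 | Up => A n n end.

Definition factor_of_coef (K : comNzRingType) (p q : nat) (c : nat -> K)
    (j : nat) : smx K :=
  match letter_min p q j with
  | Lo => fun n m => if m == n then 1
                     else if m.+1 == n then c (height p q j n) else 0
  | Up => fun n m => if m == n.+1 then 1
                     else if m == n then c (height p q j n) else 0
  end.

Definition cyclic_prod (K : comNzRingType) (p q : nat) (c : nat -> K)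
    (r : nat) : smx K :=
  sprod (rot r [seq factor_of_coef p q c j | j <- iota 0 (p + q)]).

(* Difference operators sum_k X_k S^k on sequences indexed by nat: X k h is the
   value at h of the coefficient of S^k. Since
   (X_j S^j) (Y_i S^i) = X_j Y_i(. + j) S^(i + j), the value at h involves Y_i at
   h + j; the terms leaving nat (where the coefficients X_j vanish) are 0. *)
Definition dop (K : Type) := int -> nat -> K.

Section DifferenceOperators.
Variable K : comNzRingType.
Implicit Types X Y : dop K.

Definition dop1 : dop K := fun k h => (k == 0)%:R.
Definition dmul X Y : dop K := fun k h =>
  \sum_(j \in [set: int])
     if 0 <= h%:Z + j then X j h * Y (k - j) (absz (h%:Z + j)) else 0.
Definition dexp X l : dop K := iter l (dmul X) dop1.
Definition dcomm X Y : dop K := fun k h => dmul X Y k h - dmul Y X k h.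
Definition dpos X : dop K := fun k h => if 0 <= k then X k h else 0.

(* S^q + c S^-p *)
Definition lax_op (p q : nat) (c : nat -> K) : dop K := fun k h =>
  if k == q%:Z then 1 else if k == - p%:Z then c h else 0.

Definition dop_smx X : smx K := fun h h' => X (h'%:Z - h%:Z) h.

End DifferenceOperators.

Section Hierarchy.
Variables (R : realFieldType) (N : nat).
Local Notation K := (fps R N).
(* The i-th variable is the time t_(ell i). *)
Variable ell : 'I_N -> nat.

Definition lax_solution (p q : nat) (c0 : nat -> R) (c : nat -> K) : Prop :=
  [/\ forall h, (h < p)%N -> c h = 0,
      forall h, fps_coef (c h) 0%MM = c0 h
    & forall (i : 'I_N) k h,
        fps_deriv i (lax_op p q c k h) =
        dcomm (dpos (dexp (lax_op p q c) ((p + q) * ell i))) (lax_op p q c) k h].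

Definition toda_flow (T : smx K) : Prop :=
  forall i, sderiv i T = scomm (spos (sexp T (ell i))) T.

Definition aux_rhs (l : nat) (F T1 T0 : smx K) : smx K :=
  ssub (smul (spos (sexp T1 l)) F) (smul F (spos (sexp T0 l))).

Definition root_flow (M : nat) (H : smx K) : Prop :=
  forall i, sderiv i H = scomm (spos (sexp H (M * ell i))) H.

(* Polynomial arrays: the n-th row B_n(x; t), with coefficients in R[[t]]. *)
Definition parray (s : nat) := nat -> 'rV[{poly K}]_s.

Definition act s (X : smx K) (B : parray s) : parray s :=
  fun n => \sum_(k \in [set: nat]) (X n k)%:P *: B k.

Definition mxderiv m s (i : 'I_N) (B : 'M[{poly K}]_(m, s)) :=
  map_mx (map_poly (fps_deriv i)) B.

Definition liftC s (C : 'M[K]_s) : 'M[{poly K}]_s := map_mx polyC C.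

Definition eigen_array s (T : smx K) (B : parray s) : Prop :=
  act T B = (fun n => 'X *: B n).

(* The first s rows form a nonsingular lower triangular matrix free of x. *)
Definition right_array s (T : smx K) (B : parray s) : Prop :=
  eigen_array T B /\
  exists C : 'M[K]_s, [/\ is_trig_mx C, C \in unitmx
    & forall i : 'I_s, B i = row i (liftC C)].

Definition sato_rhs s (l : nat) (T : smx K) (B : parray s) : parray s :=
  fun n => - act (sneg (sexp T l)) B n.

Definition sato s (T : smx K) (B : parray s) : Prop :=
  forall i n, mxderiv i (B n) = sato_rhs (ell i) T B n.

Definition gauged_rhs s (l : nat) (T : smx K) (B : parray s) (G : 'M[K]_s) :
  parray s := fun n => sato_rhs l T B n + B n *m liftC G.

Definition const_pmx s (W : 'M[{poly R}]_s) : 'M[{poly K}]_s :=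
  map_mx (map_poly fpsC) W.

Definition connection s (F : smx K) (B1 B0 : parray s) (W : 'M[{poly K}]_s) :=
  act F B0 = (fun n => B1 n *m W).

(* The equality of the derivatives of F B0 and B1 W, expanded by the Leibniz rule with prescribed derivatives
   dF, dB1, dB0, dW of the four terms. *)
Definition cross_compatible s (F dF : smx K) (B1 dB1 B0 dB0 : parray s)
    (W dW : 'M[{poly K}]_s) : Prop :=
  forall n, act dF B0 n + act F dB0 n = dB1 n *m W + B1 n *m dW.

(* F is a discrete Baecklund direction from T0 to T1: it intertwines two
   solutions of the Toda flows and maps the solutions of the linear problem of
   T0 to solutions of the linear problem of T1. *)
Definition baecklund (F T1 T0 : smx K) : Prop :=
  [/\ smul T1 F = smul F T0, toda_flow T0, toda_flow T1
    & forall s (B : parray s), eigen_array T0 B -> sato T0 B ->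
        eigen_array T1 (act F B) /\ sato T1 (act F B)].

Definition gauge_arr s (B : parray s) (C : 'M[K]_s) : parray s :=
  fun n => B n *m liftC C.
Definition gauge_term s (i : 'I_N) (C : 'M[K]_s) : 'M[K]_s :=
  invmx C *m map_mx (fps_deriv i) C.
Definition gauge_conn s (W : 'M[{poly K}]_s) (C1 C0 : 'M[K]_s) :=
  liftC (invmx C1) *m W *m liftC C0.

End Hierarchy.

(* Main.v *)
From HB Require Import structures.
Require Import Defs.
From mathcomp Require Import all_boot all_order all_algebra.
From mathcomp Require Import boolp classical_sets functions cardinality fsbigop.
From mathcomp Require Import mpoly zify.

Set Implicit Arguments.
Unset Strict Implicit.
Unset Printing Implicit Defensive.

Import Order.TTheory GRing.Theory Num.Theory.
Local Open Scope ring_scope.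

(** In the order of heights the matrix H of S^q + c S^-p is a single operator; in
    factor-copy order it is the cyclic block matrix with the factor F_j in the
    position (j, j + 1). Indeed the copy j consists of the heights congruent to
    j q modulo M = p + q, and both steps h -> h + q and h -> h - p lead from the
    copy j to the copy j + 1. With E_j the inclusion of the copy j (copy_incl),
    this is the identity E_j H = F_j E_{j+1} (copy_incl_lax), which gives
    E_j H^M = T_j E_j. The heights of one copy increase with the index in that
    copy, so upper triangular parts are taken block by block:
    E_j (H^(M l))_+ = (T_j^l)_+ E_j (copy_incl_spos). Multiplying the Lax
    equation, read as an equation of matrices (dop_smx_mul), by E_j on the left
    gives the auxiliary equations (factor_flow). They have the form
    dF_j = P_j F_j - F_j P_{j+1}, which telescopes along products of consecutive
    factors (run_prod_flow) and, around the whole cycle, becomes the Toda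
    equation of T_j.

    For the Christoffel connections, T_j F_j = F_j T_{j+1} moves l-th powers
    through F_j, so that the auxiliary equation is equivalent, when applied to an
    array, to F_j mapping the Sato equations of T_{j+1} to those of T_j
    (act_aux_rhs). Each T_j has q superdiagonals, the outermost constant equal
    to 1 (leading_band_cyclic), so an eigenvector array is determined by its first
    q rows (eigen_array_inj) and its rows are linearly independent over the power
    series (right_array_inj). The first fact produces the polynomial matrix W with
    F B0 = B1 W, and the Sato equations of both sides make it independent of time
    (connection_exists). The second one recovers the auxiliary equation from the
    compatibility of the connection with the flows (cross_compatible_iff). Under a
    change of gauge, both sides of that compatibility gain the same term
    (cross_compatible_gauged), so it still characterizes the auxiliary equation. *)

(** * Semi-infinite matrices with finitely supported rows *)

Section SmxTheory.
Variable K : comNzRingType.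
Implicit Types A B C X : smx K.

Lemma smx_ext A B : (forall n m, A n m = B n m) -> A = B.
Proof. by move=> AB; apply/funext => n; apply/funext => m. Qed.

Lemma fsum_nat_bound (V : nmodType) (f : nat -> V) b :
    (forall k, (b <= k)%N -> f k = 0) ->
  \sum_(k \in [set: nat]) f k = \sum_(k < b) f k.
Proof.
move=> f0; rewrite (fsbigE (index_iota 0 b)) ?iota_uniq //.
  by rewrite big_mkord; apply: eq_bigl => k; apply/mem_set.
by move=> k _; rewrite mem_index_iota -leqNgt => /f0.
Qed.

Definition row_bound A (beta : nat -> nat) :=
  forall n k, (beta n <= k)%N -> A n k = 0.

(** A uniform choice of bounds turns the finitely supported sums of the matrix
    products into sums over ordinals, to which the usual lemmas apply. *)
Lemma row_finiteP A : row_finite A <-> exists beta, row_bound A beta.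
Proof.
split=> [fA|[beta Ab] n].
  suff /choice[beta Ab] : forall n, exists b, forall k, (b <= k)%N -> A n k = 0.
    by exists beta.
  move=> n; have /finite_seqP[s sE] := fA n.
  exists (\max_(i <- s) i.+1)%N => k sk; apply/eqP/negP => /negP Ank.
  have : k \in s by have : [set` s]%classic k by rewrite -sE.
  move=> ks; have := @leq_bigmax_seq _ s predT S k ks isT.
  by move=> /leq_trans /(_ sk); rewrite ltnn.
apply: (@sub_finite_set _ _ `I_(beta n)%classic); last exact: finite_II.
by move=> k /= /eqP Ank; rewrite ltnNge; apply/negP => /Ab.
Qed.

Lemma row_finite_bound A beta : row_bound A beta -> row_finite A.
Proof. by move=> Ab; apply/row_finiteP; exists beta. Qed.

Lemma smulE A beta : row_bound A beta -> forall B n m b, (beta n <= b)%N ->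
  smul A B n m = \sum_(k < b) A n k * B k m.
Proof.
move=> Ab B n m b nb; rewrite /smul; apply: fsum_nat_bound => k bk.
by rewrite (Ab _ _ (leq_trans nb bk)) mul0r.
Qed.

(** The maximum bounds at once all the rows of B met by the row n of A. *)
Lemma row_bound_smul A B alpha beta : row_bound A alpha -> row_bound B beta ->
  row_bound (smul A B) (fun n => \max_(k < alpha n) beta k)%N.
Proof.
move=> Aa Bb n m nm; rewrite (smulE Aa _ _ (leqnn _)) big1 // => k _.
rewrite (Bb k m) ?mulr0 //; apply: leq_trans nm.
by rewrite (leq_bigmax (F := fun k : 'I__ => beta k)).
Qed.

Lemma row_finite_smul A B :
  row_finite A -> row_finite B -> row_finite (smul A B).
Proof.
move=> /row_finiteP[alpha Aa] /row_finiteP[beta Bb].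
exact: row_finite_bound (row_bound_smul Aa Bb).
Qed.

Lemma row_finite_smx1 : row_finite (smx1 K).
Proof.
apply: (@row_finite_bound _ S) => n k nk.
by rewrite /smx1; case: eqP nk => // ->; rewrite ltnn.
Qed.

Lemma row_finite_sexp A l : row_finite A -> row_finite (sexp A l).
Proof.
move=> fA; elim: l => [|l IHl]; first exact: row_finite_smx1.
exact: row_finite_smul.
Qed.

Lemma row_finite_spos A : row_finite A -> row_finite (spos A).
Proof.
move=> /row_finiteP[beta Ab]; apply: (@row_finite_bound _ beta) => n k nk.
by rewrite /spos Ab // if_same.
Qed.

Lemma row_finite_ssub A B :
  row_finite A -> row_finite B -> row_finite (ssub A B).
Proof.
move=> /row_finiteP[alpha Aa] /row_finiteP[beta Bb].
apply: (@row_finite_bound _ (fun n => maxn (alpha n) (beta n))) => n k.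
by rewrite geq_max /ssub => /andP[nk nk']; rewrite Aa // Bb // subr0.
Qed.

Lemma row_finite_sneg A : row_finite A -> row_finite (sneg A).
Proof. by move=> fA; apply: row_finite_ssub => //; apply: row_finite_spos. Qed.

Lemma smulA A B C : row_finite A -> row_finite B ->
  smul A (smul B C) = smul (smul A B) C.
Proof.
move=> /row_finiteP[alpha Aa] /row_finiteP[beta Bb]; apply: smx_ext => n m.
rewrite (smulE (row_bound_smul Aa Bb) _ _ (leqnn _)).
rewrite (smulE Aa _ _ (leqnn _)).
under eq_bigr => k _.
  rewrite (smulE Bb _ _ (leq_bigmax (F := fun k : 'I_(alpha n) => beta k) k)).
  by rewrite big_distrr; over.
rewrite exchange_big; apply: eq_bigr => j _ /=.
rewrite (smulE Aa _ _ (leqnn _)) big_distrl; apply: eq_bigr => k _ /=.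
by rewrite mulrA.
Qed.

Lemma smul1l A : smul (smx1 K) A = A.
Proof.
apply: smx_ext => n m; rewrite (@smulE _ S _ _ _ _ n.+1) //; last first.
  by move=> i k ik; rewrite /smx1 ltn_eqF.
rewrite big_ord_recr /= /smx1 eqxx mul1r big1 ?add0r // => k _.
by rewrite gtn_eqF // mul0r.
Qed.

Lemma smul1r A : row_finite A -> smul A (smx1 K) = A.
Proof.
move=> /row_finiteP[beta Ab]; apply: smx_ext => n m.
have mb : (m < maxn (beta n) m.+1)%N by rewrite leq_maxr.
rewrite (smulE Ab _ _ (leq_maxl _ m.+1)) (bigD1 (Ordinal mb)) //=.
rewrite /smx1 eqxx mulr1 big1 ?addr0 // => k.
by rewrite -val_eqE /= => /negPf ->; rewrite mulr0.
Qed.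

Lemma smul0l A : smul (fun _ _ => 0) A = fun _ _ => 0.
Proof. by apply: smx_ext => n m; apply: fsbig1 => k _; rewrite mul0r. Qed.

Lemma smul0r A : smul A (fun _ _ => 0) = fun _ _ => 0.
Proof. by apply: smx_ext => n m; apply: fsbig1 => k _; rewrite mulr0. Qed.

Lemma smulBl A B C : row_finite A -> row_finite B ->
  smul (ssub A B) C = ssub (smul A C) (smul B C).
Proof.
move=> /row_finiteP[alpha Aa] /row_finiteP[beta Bb]; apply: smx_ext => n m.
set b := maxn (alpha n) (beta n).
rewrite /ssub (smulE Aa _ _ (leq_maxl _ (beta n))).
rewrite (smulE Bb _ _ (leq_maxr (alpha n) _)).
rewrite [LHS](fsum_nat_bound (b := b)) => [|k].
  by rewrite -sumrB; apply: eq_bigr => k _; rewrite mulrBl.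
by rewrite geq_max => /andP[nk nk']; rewrite Aa // Bb // subr0 mul0r.
Qed.

Lemma smulBr A B C : row_finite A ->
  smul A (ssub B C) = ssub (smul A B) (smul A C).
Proof.
move=> /row_finiteP[alpha Aa]; apply: smx_ext => n m.
rewrite /ssub !(smulE Aa _ _ (leqnn _)) -sumrB.
by apply: eq_bigr => k _; rewrite mulrBr.
Qed.

Lemma sexp_intertwine A B X l : row_finite A -> row_finite B -> row_finite X ->
  smul A X = smul X B -> smul (sexp A l) X = smul X (sexp B l).
Proof.
move=> fA fB fX AX; elim: l => [|l IHl]; first by rewrite /= smul1l smul1r.
rewrite /= -smulA ?IHl ?smulA ?AX //; exact: row_finite_sexp.
Qed.

(** For an M-periodic sequence of factors the cyclic products are the runs of
    length M; indexing them by all of nat avoids rotations and wrap-around. *)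
Definition run_prod (F : nat -> smx K) j k := sprod [seq F i | i <- iota j k].

Lemma row_finite_run_prod F j k : (forall i, row_finite (F i)) ->
  row_finite (run_prod F j k).
Proof.
move=> fF; elim: k j => [|k IHk] j; first exact: row_finite_smx1.
by apply: row_finite_smul; [apply: fF | apply: IHk].
Qed.

Lemma run_prodD F j k l : (forall i, row_finite (F i)) ->
  run_prod F j (k + l) = smul (run_prod F j k) (run_prod F (j + k) l).
Proof.
move=> fF; rewrite /run_prod; elim: k j => [|k IHk] j.
  by rewrite /= smul1l addn0.
by rewrite addSn /= IHk -addSnnS smulA //; apply: row_finite_run_prod.
Qed.

Lemma run_prod1 F j : row_finite (F j) -> run_prod F j 1 = F j.
Proof. exact: smul1r. Qed.

End SmxTheory.

(** * Derivations of formal power series and of arrays of polynomials *)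

Section Derivations.
Variables (R : realFieldType) (N : nat).
Local Notation K := (fps R N).
Implicit Types (i : 'I_N) (f g : K).

Lemma fps_deriv_is_zmod_morphism i : zmod_morphism (@fps_deriv R N i).
Proof. by move=> f g; apply: fps_ext => m /=; rewrite -mulrnBl. Qed.
HB.instance Definition _ i := GRing.isZmodMorphism.Build K K
  (@fps_deriv R N i) (fps_deriv_is_zmod_morphism i).

(** Coefficientwise this is the product rule of truncated polynomials; the
    truncation orders differ by one because the derivative of a product in
    degree d sees the factors up to degree d + 1. *)
Lemma fps_derivM i f g :
  fps_deriv i (f * g) = fps_deriv i f * g + f * fps_deriv i g.
Proof.
apply: fps_ext => m; set d := (mdeg m).+1.
rewrite -[LHS]/(fps_coef (fps_mul f g) (m + U_(i))%MM *+ (m i).+1).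
rewrite -[RHS]/(fps_coef (fps_mul (fps_deriv i f) g) m +
                fps_coef (fps_mul f (fps_deriv i g)) m).
rewrite (@fps_mulE _ _ d.+1); last by rewrite mdegD mdeg1 addn1.
rewrite -mcoeff_deriv mderivM mcoeffD.
have low h k : (mdeg k <= mdeg m)%N ->
    (fps_trunc d.+1 h)@_k = (fps_trunc d h)@_k.
  by move=> km; rewrite !fps_truncE // /d ltnS // ltnW.
have dlow h k : (mdeg k <= mdeg m)%N ->
    (mderiv i (fps_trunc d.+1 h))@_k = (fps_trunc d (fps_deriv i h))@_k.
  move=> km; rewrite mcoeff_deriv !fps_truncE //.
  by rewrite mdegD mdeg1 addn1 /d !ltnS.
by congr (_ + _); rewrite (@fps_mulE _ _ d) //; apply: mcoeff_mul_low;
  auto.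
Qed.

Lemma fps_deriv1 i : fps_deriv i (1 : K) = 0.
Proof.
have := fps_derivM i 1 1; rewrite !mulr1 mul1r.
by rewrite -[X in X = _ -> _]addr0 => /addrI <-.
Qed.

(** A nonzero exponent m has some m i > 0, and m i is nonzero in R. *)
Lemma fps_deriv_const f : (forall i, fps_deriv i f = 0) ->
  f = fpsC (fps_coef f 0%MM).
Proof.
move=> f0; apply: fps_ext => m /=; case: eqP => [-> //|/eqP m0].
have [i mi] : exists i, m i != 0%N.
  apply/existsP; apply: contraNT m0 => /existsPn m0; apply/eqP/mnmP => i.
  by rewrite mnm0E; apply/eqP; have := m0 i; rewrite negbK.
have mE : m = (m - U_(i) + U_(i))%MM.
  by rewrite submK //; apply/mnm_lepP => j; rewrite mnm1E; case: eqP => // <-;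
    rewrite lt0n.
have /eqP := congr1 (fun g : K => fps_coef g (m - U_(i))%MM) (f0 i).
by rewrite /= -mE if_same mulrn_eq0 => /eqP.
Qed.

Lemma sderiv_smul i (A B : smx K) n m : row_finite A ->
  sderiv i (smul A B) n m = smul (sderiv i A) B n m + smul A (sderiv i B) n m.
Proof.
move=> /row_finiteP[beta Ab].
have dAb : row_bound (sderiv i A) beta.
  by move=> j k jk; rewrite /sderiv Ab ?raddf0.
rewrite /sderiv (smulE Ab _ _ (leqnn _)) raddf_sum.
rewrite (smulE dAb _ _ (leqnn _)) (smulE Ab _ _ (leqnn _)) -big_split /=.
by apply: eq_bigr => k _; rewrite fps_derivM.
Qed.

Lemma row_finite_sderiv i (A : smx K) : row_finite A -> row_finite (sderiv i A).
Proof.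
move=> /row_finiteP[beta Ab]; apply: (@row_finite_bound _ _ beta) => j k jk.
by rewrite /sderiv Ab ?raddf0.
Qed.

Lemma poly_derivM i (P Q : {poly K}) :
  map_poly (fps_deriv i) (P * Q) =
  map_poly (fps_deriv i) P * Q + P * map_poly (fps_deriv i) Q.
Proof.
apply/polyP => k; rewrite coefD !coefM coef_map coefM raddf_sum -big_split /=.
by apply: eq_bigr => j _; rewrite fps_derivM !coef_map.
Qed.

Lemma mxderivM m s t i (A : 'M[{poly K}]_(m, s)) (B : 'M_(s, t)) :
  mxderiv i (A *m B) = mxderiv i A *m B + A *m mxderiv i B.
Proof.
apply/matrixP => j k; rewrite !mxE raddf_sum -big_split /=.
by apply: eq_bigr => u _; rewrite !mxE poly_derivM.
Qed.

Lemma mxderivB m s i : zmod_morphism (@mxderiv R N m s i).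
Proof. by move=> A B; apply/matrixP => j k; rewrite !mxE raddfB. Qed.
HB.instance Definition _ m s i := GRing.isZmodMorphism.Build
  'M[{poly K}]_(m, s) 'M[{poly K}]_(m, s) (@mxderiv R N m s i)
  (@mxderivB m s i).

Lemma mxderivZ m s i (x : K) (B : 'M[{poly K}]_(m, s)) :
  mxderiv i (x%:P *: B) = (fps_deriv i x)%:P *: B + x%:P *: mxderiv i B.
Proof.
apply/matrixP => j k; rewrite !mxE poly_derivM; congr (_ * _ + _).
by apply/polyP => u; rewrite coef_map !coefC; case: ifP => // _; rewrite raddf0.
Qed.

Lemma mxderiv_liftC s i (C : 'M[K]_s) :
  mxderiv i (liftC C) = liftC (map_mx (fps_deriv i) C).
Proof.
apply/matrixP => j k; rewrite !mxE.
by apply/polyP => u; rewrite coef_map !coefC; case: ifP => // _; rewrite raddf0.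
Qed.

Lemma fps_derivC i (x : R) : fps_deriv i (fpsC x : K) = 0.
Proof.
apply: fps_ext => m /=; rewrite if_same.
case: eqP => [/mnmP/(_ i)|_]; last by rewrite mul0rn.
by rewrite mnmDE mnm1E eqxx addn1 mnm0E.
Qed.

Lemma mxderiv_const s i (W : 'M[{poly R}]_s) : mxderiv i (const_pmx N W) = 0.
Proof.
apply/matrixP => j k; rewrite !mxE; apply/polyP => u.
by rewrite coef0 coef_map coef_map_id0 //; apply: fps_derivC.
Qed.

Lemma mxderiv_eq0_const s (W : 'M[{poly K}]_s) :
  (forall i, mxderiv i W = 0) -> exists W0, W = const_pmx N W0.
Proof.
move=> W0; exists (map_mx (map_poly (fun f => fps_coef f 0%MM)) W).
apply/matrixP => j k; rewrite !mxE; apply/polyP => u.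
rewrite !coef_map_id0 //=; last by rewrite eqxx.
apply: fps_deriv_const => i; move/matrixP: (W0 i) => /(_ j k).
by rewrite !mxE => /polyP/(_ u); rewrite coef_map coef0.
Qed.

End Derivations.

(** * The action on arrays of polynomial rows *)

Section Action.
Variables (R : realFieldType) (N s : nat).
Local Notation K := (fps R N).
Implicit Types (A X : smx K) (B : parray R N s).

Lemma actE X beta : row_bound X beta -> forall B n b, (beta n <= b)%N ->
  act X B n = \sum_(k < b) (X n k)%:P *: B k.
Proof.
move=> Xb B n b nb; apply: fsum_nat_bound => k bk.
by rewrite (Xb _ _ (leq_trans nb bk)) scale0r.
Qed.

Lemma act_ssub A X B : row_finite A -> row_finite X ->
  act (ssub A X) B = fun n => act A B n - act X B n.
Proof.
move=> /row_finiteP[alpha Aa] /row_finiteP[beta Xb]; apply/funext => n.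
rewrite (actE Aa _ (leq_maxl _ (beta n))) (actE Xb _ (leq_maxr (alpha n) _)).
rewrite [LHS](fsum_nat_bound (b := maxn (alpha n) (beta n))) => [|k].
  by rewrite -sumrB; apply: eq_bigr => k _; rewrite rmorphB scalerBl.
rewrite geq_max /ssub => /andP[nk nk'].
by rewrite Aa // Xb // subr0 scale0r.
Qed.

Lemma act_smul A X B : row_finite A -> row_finite X ->
  act (smul A X) B = act A (act X B).
Proof.
move=> /row_finiteP[alpha Aa] /row_finiteP[beta Xb]; apply/funext => n.
rewrite (actE (row_bound_smul Aa Xb) _ (leqnn _)) (actE Aa _ (leqnn _)).
under [RHS]eq_bigr => k _.
  rewrite (actE Xb _ (leq_bigmax (F := fun k : 'I_(alpha n) => beta k) k)).
  by rewrite scaler_sumr; over.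
rewrite exchange_big; apply: eq_bigr => j _ /=.
rewrite (smulE Aa _ _ (leqnn _)) rmorph_sum scaler_suml.
by apply: eq_bigr => k _; rewrite rmorphM scalerA.
Qed.

Lemma act_mulmx X B t (W : 'M[{poly K}]_(s, t)) : row_finite X ->
  act X (fun n => B n *m W) = fun n => act X B n *m W.
Proof.
move=> /row_finiteP[beta Xb]; apply/funext => n.
rewrite (actE Xb _ (leqnn _)) [LHS](fsum_nat_bound (b := beta n)) => [|k nk].
  by rewrite mulmx_suml; apply: eq_bigr => k _; rewrite scalemxAl.
by rewrite Xb // scale0r.
Qed.

Lemma act_scale X B (P : {poly K}) : row_finite X ->
  act X (fun n => P *: B n) = fun n => P *: act X B n.
Proof.
move=> /row_finiteP[beta Xb]; apply/funext => n.
rewrite !(actE Xb _ (leqnn _)) scaler_sumr.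
by apply: eq_bigr => k _; rewrite !scalerA mulrC.
Qed.

Lemma act_opp X B : row_finite X ->
  act X (fun n => - B n) = fun n => - act X B n.
Proof.
move=> fX; rewrite (_ : (fun n => - B n) = fun n => (-1) *: B n).
  by rewrite act_scale //; apply/funext => n; rewrite scaleN1r.
by apply/funext => n; rewrite scaleN1r.
Qed.

Lemma act_add X B B' : row_finite X ->
  act X (fun n => B n + B' n) = fun n => act X B n + act X B' n.
Proof.
move=> /row_finiteP[beta Xb]; apply/funext => n.
rewrite !(actE Xb _ (leqnn _)) -big_split.
by apply: eq_bigr => k _; rewrite scalerDr.
Qed.

Lemma mxderiv_act i X B n : row_finite X ->
  mxderiv i (act X B n) =
  act (sderiv i X) B n + act X (fun k => mxderiv i (B k)) n.
Proof.
move=> /row_finiteP[beta Xb].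
have dXb : row_bound (sderiv i X) beta.
  by move=> j k jk; rewrite /sderiv Xb ?raddf0.
rewrite (actE dXb _ (leqnn _)) !(actE Xb _ (leqnn _)) raddf_sum -big_split /=.
by apply: eq_bigr => k _; rewrite mxderivZ.
Qed.

End Action.

(** * Difference operators as semi-infinite matrices *)

Section DopMatrix.
Variable K : comNzRingType.
Implicit Types X Y : dop K.

(** The terms of a product of difference operators that stay in nat are those
    of the matrix product, through the substitution k = h + j. *)
Lemma dop_smx_mul X Y : dop_smx (dmul X Y) = smul (dop_smx X) (dop_smx Y).
Proof.
apply: smx_ext => h h'; rewrite /dop_smx /dmul /smul.
pose g j := X j h * Y (h'%:Z - h%:Z - j) (absz (h%:Z + j)).
rewrite (eq_fsbigr (fun j => if j \in [set j | 0 <= h%:Z + j]%classic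
                             then g j else 0)); last first.
  move=> j _; rewrite /g.
  by case: ifPn => hj; [rewrite mem_set|rewrite memNset //; apply/negP].
rewrite -fsbig_mkcondr setTI.
rewrite (reindex_fsbig (fun k : nat => k%:Z - h%:Z) [set: nat]).
  apply: eq_fsbigr => k _; rewrite /g addrCA subrr addr0 absz_nat.
  by congr (_ * Y _ _); rewrite opprB addrA subrK.
split=> [k _ /=|k k' _ _ /addIr[]//|j /= hj].
  by rewrite addrCA subrr addr0.
exists (absz (h%:Z + j)) => //; rewrite gez0_abs //.
by rewrite addrAC subrr add0r.
Qed.

Lemma dop_smx_exp X l : dop_smx (dexp X l) = sexp (dop_smx X) l.
Proof.
elim: l => [|l IHl].
  apply: smx_ext => h h'; rewrite /dop_smx /= /dop1 /smx1 subr_eq0.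
  by rewrite eqz_nat eq_sym.
by rewrite -[dexp X l.+1]/(dmul X (dexp X l)) dop_smx_mul IHl.
Qed.

Lemma dop_smx_pos X : dop_smx (dpos X) = spos (dop_smx X).
Proof.
by apply: smx_ext => h h'; rewrite /dop_smx /dpos /spos subr_ge0 lez_nat.
Qed.

Lemma dop_smx_comm X Y :
  dop_smx (dcomm X Y) = scomm (dop_smx X) (dop_smx Y).
Proof.
apply: smx_ext => h h'; rewrite /scomm /ssub -!dop_smx_mul //.
Qed.

End DopMatrix.

(** * The factor copies inside the height order *)

Section Heights.
Variables (p q : nat).
Hypotheses (p_gt0 : (0 < p)%N) (q_gt0 : (0 < q)%N).
Local Notation M := (p + q)%N.

Lemma ltn_res j : (res p q j < M)%N.
Proof. by rewrite ltn_mod addn_gt0 p_gt0. Qed.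

Lemma eq_res j j' : j = j' %[mod M] -> res p q j = res p q j'.
Proof. by move=> jj'; rewrite /res -modnMml jj' modnMml. Qed.

(** Coprimality enters here: q is invertible modulo p + q. *)
Lemma res_inj j j' : coprime p q -> res p q j = res p q j' -> j = j' %[mod M].
Proof.
move=> pq; wlog le_jj' : j j' / (j <= j')%N.
  by move=> hw; case: (leqP j j') => [|/ltnW] jj' rjj';
    [|apply/esym]; apply: hw.
move=> /esym/eqP; rewrite /res eqn_mod_dvd ?leq_mul2r ?le_jj' ?orbT //.
rewrite -mulnBl Gauss_dvdl; last by rewrite /coprime gcdnC gcdnDr gcdnC.
by rewrite -eqn_mod_dvd // => /eqP.
Qed.

Lemma resS j : res p q j.+1 = (if res p q j < p then res p q j + q
                               else res p q j - p)%N.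
Proof.
have lt_j := ltn_res j; rewrite {1}/res mulSn addnC -modnDml -/(res p q j).
case: ltnP => jp; first by rewrite modn_small // ltn_add2r.
by rewrite -{1}(subnK jp) -addnA modnDr modn_small //; lia.
Qed.

Lemma eq_height j j' n : j = j' %[mod M] -> height p q j n = height p q j' n.
Proof. by move=> /eq_res; rewrite /height => ->. Qed.

Lemma leq_height j n m : (height p q j n <= height p q j m)%N = (n <= m)%N.
Proof. by rewrite leq_add2r leq_pmul2l // addn_gt0 p_gt0. Qed.

Lemma height_eq_same j n m : (height p q j n == height p q j m) = (n == m).
Proof. by rewrite !eqn_leq !leq_height. Qed.

(** The step h -> h + q or h -> h - p to the copy j + 1 keeps the index n when it
    stays in the same window of M consecutive heights. The residue decides which
    of the two does; the other one changes the index by one. *)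
Lemma height_lower j n : (res p q j < p)%N ->
  height p q j.+1 n = (height p q j n + q)%N /\
  height p q j n.+1 = (height p q j.+1 n + p)%N.
Proof.
move=> jp; rewrite /height resS jp mulnS; move: (M * n)%N => x.
by split; lia.
Qed.

Lemma height_upper j n : (p <= res p q j)%N ->
  height p q j n = (height p q j.+1 n + p)%N /\
  height p q j.+1 n.+1 = (height p q j n + q)%N.
Proof.
move=> jp; rewrite /height resS ltnNge jp mulnS /=; move: (M * n)%N => x.
by split; lia.
Qed.

Lemma height_inj j j' n m : coprime p q ->
  height p q j n = height p q j' m -> j = j' %[mod M].
Proof.
move=> pq /(congr1 (modn^~ M)); rewrite /height ![(M * _)%N]mulnC !modnMDl.
by rewrite !(modn_small (ltn_res _)); apply: res_inj.
Qed.

Section Copies.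
Variables (K : comNzRingType) (c : nat -> K).
Local Notation H := (dop_smx (lax_op p q c)).
Local Notation F := (factor_of_coef p q c).
Implicit Types (A X : smx K) (j n m : nat).

(** The inclusion of the copy j in the heights, as a matrix: multiplying by it on
    the left extracts the rows of the copy j, and multiplying by it on the right
    places the columns of a matrix at the heights of the copy j. Identities
    between blocks thus become associativity. *)
Definition copy_incl j : smx K := fun n h => (h == height p q j n)%:R.

Lemma eq_copy_incl j j' : j = j' %[mod M] -> copy_incl j = copy_incl j'.
Proof.
by move=> jj'; apply: smx_ext => n h; rewrite /copy_incl (eq_height _ jj').
Qed.

Lemma row_bound_copy_incl j :
  row_bound (copy_incl j) (fun n => (height p q j n).+1).
Proof. by move=> n h nh; rewrite /copy_incl gtn_eqF. Qed.

Lemma row_finite_copy_incl j : row_finite (copy_incl j).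
Proof. exact/row_finite_bound/row_bound_copy_incl. Qed.

Lemma copy_incl_mul j A n h : smul (copy_incl j) A n h = A (height p q j n) h.
Proof.
rewrite (smulE (@row_bound_copy_incl j) _ _ (leqnn _)) big_ord_recr /=.
rewrite big1 ?add0r => [|k _]; first by rewrite /copy_incl eqxx mul1r.
by rewrite /copy_incl ltn_eqF // mul0r.
Qed.

Lemma mul_copy_incl X j n m : row_finite X ->
  smul X (copy_incl j) n (height p q j m) = X n m.
Proof.
move=> fX; rewrite -[X in RHS](smul1r fX); apply: eq_fsbigr => k _.
by rewrite /copy_incl /smx1 height_eq_same [m == k]eq_sym.
Qed.

Lemma mul_copy_incl0 X j n h : (forall m, h <> height p q j m) ->
  smul X (copy_incl j) n h = 0.
Proof.
move=> hj; apply: fsbig1 => k _; rewrite /copy_incl.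
by case: eqP => [/hj|_] //; rewrite mulr0.
Qed.

Lemma mul_copy_incl_inj j X Y : row_finite X -> row_finite Y ->
  smul X (copy_incl j) = smul Y (copy_incl j) -> X = Y.
Proof.
move=> fX fY XY; apply: smx_ext => n m.
by rewrite -(mul_copy_incl j n m fX) XY mul_copy_incl.
Qed.

(** Heights in one copy are ordered like the indices in that copy, so taking
    upper triangular parts commutes with passing to a diagonal block. *)
Lemma copy_incl_spos A X j : row_finite X ->
  smul (copy_incl j) A = smul X (copy_incl j) ->
  smul (copy_incl j) (spos A) = smul (spos X) (copy_incl j).
Proof.
move=> fX AX; apply: smx_ext => n h; rewrite copy_incl_mul /spos.
rewrite -(copy_incl_mul j A) AX.
have [[m ->]|/forallNP hj] := pselect (exists m, h = height p q j m).
  by rewrite leq_height !mul_copy_incl //; apply: row_finite_spos.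
by rewrite !mul_copy_incl0 // if_same.
Qed.

Lemma eq_factor j j' : j = j' %[mod M] -> F j = F j'.
Proof.
move=> jj'; rewrite /factor_of_coef /letter_min (eq_res jj').
by case: ifP => _; apply: smx_ext => n m; rewrite (eq_height n jj').
Qed.

Lemma eq_run_prod j j' k : j = j' %[mod M] -> run_prod F j k = run_prod F j' k.
Proof.
move=> jj'; rewrite /run_prod -[j]addn0 -[j']addn0 !iotaDl -!map_comp.
congr sprod; apply: eq_map => i /=; apply: eq_factor.
by rewrite -modnDml jj' modnDml.
Qed.

Lemma cyclic_prodE r : (r <= M)%N -> cyclic_prod p q c r = run_prod F r M.
Proof.
move=> rM; rewrite /cyclic_prod /run_prod -map_rot; congr sprod.
rewrite /rot drop_iota take_iota (minn_idPl rM) add0n.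
rewrite -[in RHS](subnK rM) iotaD !map_cat; congr (_ ++ _).
rewrite subnKC // (_ : iota M r = map (addn M) (iota 0 r)) -?map_comp.
  by apply: eq_map => i /=; apply: eq_factor; rewrite modnDl.
by rewrite -iotaDl addn0.
Qed.

Lemma row_bound_factor j : row_bound (F j) (fun n => n.+2).
Proof.
move=> n m nm; rewrite /factor_of_coef; case: letter_min.
  by rewrite !gtn_eqF //; lia.
by rewrite !gtn_eqF //; lia.
Qed.

Lemma row_finite_factor j : row_finite (F j).
Proof. exact/row_finite_bound/row_bound_factor. Qed.

Lemma lax_smxE h h' :
  H h h' = (h' == h + q)%N%:R + c h * (h == h' + p)%N%:R.
Proof.
rewrite /dop_smx /lax_op.
have -> : (h'%:Z - h%:Z == q%:Z) = (h' == h + q)%N by lia.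
have -> : (h'%:Z - h%:Z == - p%:Z) = (h == h' + p)%N by lia.
case: eqP => [->|_]; last by case: eqP => _; rewrite ?mulr1 ?mulr0 add0r.
by rewrite (_ : (h == _) = false) ?mulr0 ?addr0 //; lia.
Qed.

Lemma row_bound_lax : row_bound H (fun h => (h + q).+1).
Proof.
move=> h h' hh'; rewrite lax_smxE.
rewrite (_ : (h' == _) = false); last by lia.
by rewrite (_ : (h == _) = false) ?mulr0 ?addr0 //; lia.
Qed.

Lemma row_finite_lax : row_finite H.
Proof. exact/row_finite_bound/row_bound_lax. Qed.

(** In factor-copy order the Lax matrix sends the copy j to the copy j + 1, and
    its only block there is the factor F j: the heights h + q and h - p lie in
    the copy j + 1, and the two types of letters tell which of them carries the
    index n. *)
Lemma copy_incl_lax j : smul (copy_incl j) H = smul (F j) (copy_incl j.+1).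
Proof.
apply: smx_ext => n h; rewrite copy_incl_mul lax_smxE.
rewrite (smulE (@row_bound_factor j) _ _ (leqnn _)) !big_ord_recr /=.
rewrite /factor_of_coef /letter_min /copy_incl; case: ltnP => jp.
  have [<- _] := height_lower n jp.
  rewrite eqxx mul1r (gtn_eqF (ltnSn n)) (gtn_eqF (leqnSn n.+1)) mul0r addr0.
  rewrite addrC; congr (_ + _).
  case: n => [|n].
    rewrite big_ord0 ltn_eqF ?mulr0 //.
    by rewrite /height muln0 add0n (leq_trans jp) // leq_addl.
  have [_ ->] := height_lower n jp.
  rewrite big_ord_recr /= eqxx (ltn_eqF (ltnSn n)) big1 ?add0r => [|k _].
    by rewrite eqn_add2r eq_sym.
  have kn := ltn_ord k.
  by rewrite (ltn_eqF (leqW kn)) (ltn_eqF (kn : (k.+1 < n.+1)%N)) mul0r.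
have [hp <-] := height_upper n jp.
rewrite !eqxx (ltn_eqF (ltnSn n)) mul1r addrC big1 ?add0r => [|k _].
  by rewrite {2}hp eqn_add2r [height p q j.+1 n == h]eq_sym.
by rewrite (ltn_eqF (leqW (ltn_ord k))) (ltn_eqF (ltn_ord k)) mul0r.
Qed.

Lemma copy_incl_lax_exp j k :
  smul (copy_incl j) (sexp H k) = smul (run_prod F j k) (copy_incl (j + k)).
Proof.
have fF := row_finite_factor; have fH := row_finite_lax.
have fE := row_finite_copy_incl.
elim: k j => [|k IHk] j; first by rewrite /= smul1l addn0 smul1r.
rewrite /= smulA // copy_incl_lax -smulA // IHk smulA ?addSnnS //.
exact: row_finite_run_prod.
Qed.

Lemma run_prod_exp j l : run_prod F j (M * l) = sexp (run_prod F j M) l.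
Proof.
elim: l => [|l IHl]; first by rewrite muln0.
rewrite mulnS run_prodD /= -?IHl; last exact: row_finite_factor.
by congr smul; apply: eq_run_prod; rewrite modnDr.
Qed.

(** The bands for which the row n of T B = x B can be solved for B (n + d). *)
Definition leading_band A d :=
  forall n, A n (n + d)%N = 1 /\ forall m, (n + d < m)%N -> A n m = 0.

Lemma leading_band_smul A B d e : leading_band A d -> leading_band B e ->
  leading_band (smul A B) (d + e).
Proof.
move=> Ad Be n; have Ab : row_bound A (fun n => (n + d).+1).
  by move=> k m /(proj2 (Ad k)).
have step m : (n + (d + e) <= m)%N -> smul A B n m = B (n + d)%N m.
  move=> le_m; rewrite (smulE Ab _ _ (leqnn _)) big_ord_recr /=.
  rewrite (proj1 (Ad n)) mul1r big1 ?add0r // => k _.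
  by rewrite (proj2 (Be k)) ?mulr0 //; have := ltn_ord k; lia.
split=> [|m lt_m]; first by rewrite step // addnA (proj1 (Be _)).
by rewrite step ?(proj2 (Be _)) //; lia.
Qed.

Lemma leading_band_lax_exp k : leading_band (sexp H k) (k * q).
Proof.
elim: k => [|k IHk].
  move=> n; rewrite mul0n addn0 /= /smx1 eqxx; split=> // m nm.
  by rewrite ltn_eqF.
rewrite mulSn; apply: leading_band_smul => // n; rewrite !lax_smxE eqxx.
split=> [|m nm]; last exact: row_bound_lax.
by rewrite (_ : (n == _) = false) ?mulr0 ?addr0 //; lia.
Qed.

(** The leading entry of the block T_j of H ^ M is read off from H ^ M itself:
    in the copy j, raising the index by q raises the height by M q. *)
Lemma leading_band_cyclic j : leading_band (run_prod F j M) q.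
Proof.
have fP : row_finite (run_prod F j M).
  by apply: row_finite_run_prod => i; apply: row_finite_factor.
have TE n m : run_prod F j M n m = sexp H M (height p q j n) (height p q j m).
  rewrite -copy_incl_mul copy_incl_lax_exp (@eq_copy_incl _ j) ?modnDr //.
  by rewrite mul_copy_incl.
move=> n; have [H1 H0] := leading_band_lax_exp M (height p q j n).
have hq : (height p q j n + M * q)%N = height p q j (n + q).
  by rewrite /height; lia.
rewrite !TE; split=> [|m nm]; first by rewrite -hq.
by rewrite TE H0 // hq ltnNge leq_height -ltnNge.
Qed.

Lemma lax_block j j' n n' : coprime p q ->
  H (height p q j n) (height p q j' n') =
  if j' == j.+1 %[mod M] then F j n n' else 0.
Proof.
move=> pq; rewrite -copy_incl_mul copy_incl_lax; case: eqP => jj'.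
  by rewrite (eq_height n' jj') mul_copy_incl //; apply: row_finite_factor.
by rewrite mul_copy_incl0 // => m /(height_inj pq).
Qed.

Lemma lax_exp_block j j' n n' : coprime p q ->
  sexp H M (height p q j n) (height p q j' n') =
  if j' == j %[mod M] then run_prod F j M n n' else 0.
Proof.
move=> pq; rewrite -copy_incl_mul copy_incl_lax_exp.
rewrite (@eq_copy_incl _ j) ?modnDr //; case: eqP => jj'.
  rewrite (eq_height n' jj') mul_copy_incl //.
  by apply: row_finite_run_prod => i; apply: row_finite_factor.
by rewrite mul_copy_incl0 // => m /(height_inj pq).
Qed.

Lemma cyclic_intertwine j :
  smul (run_prod F j M) (F j) = smul (F j) (run_prod F j.+1 M).
Proof.
have fF := row_finite_factor.
rewrite -[F j in LHS](eq_factor (modnDr _ _)) -[F (j + M)](run_prod1 (fF _)).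
by rewrite -run_prodD // addn1.
Qed.

End Copies.
End Heights.

(** * The Toda flows *)

Section Flows.
Variables (R : realFieldType) (N p q : nat) (ell : 'I_N -> nat).
Hypotheses (p_gt0 : (0 < p)%N) (q_gt0 : (0 < q)%N).
Local Notation K := (fps R N).
Local Notation M := (p + q)%N.
Variables (c0 : nat -> R) (c : nat -> K).
Hypothesis c_lax : lax_solution ell p q c0 c.
Local Notation H := (dop_smx (lax_op p q c)).
Local Notation F := (factor_of_coef p q c).

Lemma lax_root_flow : root_flow ell M H.
Proof.
case: c_lax => _ _ Lc i.
rewrite -dop_smx_exp -dop_smx_pos -dop_smx_comm.
by apply: smx_ext => h h'; apply: Lc.
Qed.

(** The row block j and column block j + 1 of the flow of H. Right multiplication
    by E_{j+1} is injective, so it suffices to compare after that product. *)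
Lemma factor_flow j i :
  sderiv i (F j) = aux_rhs (ell i) (F j) (run_prod F j M) (run_prod F j.+1 M).
Proof.
have fF k : row_finite (F k) by apply: row_finite_factor.
have fT k : row_finite (run_prod F k M) by apply: row_finite_run_prod.
have fP k : row_finite (spos (sexp (run_prod F k M) (ell i))).
  by apply/row_finite_spos/row_finite_sexp.
have fE k : row_finite (copy_incl p q K k) by apply: row_finite_copy_incl.
have fH : row_finite H by apply: row_finite_lax.
have fHP : row_finite (spos (sexp H (M * ell i))).
  by apply/row_finite_spos/row_finite_sexp.
have Epos k : smul (copy_incl p q K k) (spos (sexp H (M * ell i))) =
    smul (spos (sexp (run_prod F k M) (ell i))) (copy_incl p q K k).
  apply: copy_incl_spos => //; first exact: row_finite_sexp.
  rewrite copy_incl_lax_exp // run_prod_exp //; congr smul.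
  by apply: eq_copy_incl; rewrite mulnC addnC modnMDl.
(* The inclusions are constant in time, so the derivative of E_j H = F_j E_{j+1}
   only involves those of H and F_j. *)
have dE k : sderiv i (copy_incl p q K k) = fun _ _ => 0.
  by apply: smx_ext => n h; rewrite /sderiv /copy_incl; case: eqP => _;
    [exact: fps_deriv1|exact: raddf0].
have dEH : smul (sderiv i (F j)) (copy_incl p q K j.+1) =
           smul (copy_incl p q K j) (sderiv i H).
  apply: smx_ext => n h.
  have := congr1 (fun A => sderiv i A n h) (copy_incl_lax p_gt0 q_gt0 c j).
  by rewrite !sderiv_smul // !dE smul0l smul0r add0r addr0.
apply: (mul_copy_incl_inj (j := j.+1) p_gt0 (q := q)).
- exact: row_finite_sderiv.
- by apply: row_finite_ssub; apply: row_finite_smul.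
rewrite dEH lax_root_flow smulBr // smulBl; try exact: row_finite_smul.
rewrite (smulA _ (fE j) fHP) Epos -(smulA _ (fP j) (fE j)).
rewrite (smulA _ (fE j) fH) !copy_incl_lax // -(smulA _ (fF j) (fE j.+1)) Epos.
by rewrite !smulA.
Qed.

(** The inner terms of the Leibniz expansion cancel: each F_l contributes
    - F_l P_{l+1}, and its successor contributes P_{l+1} F_{l+1}. *)
Lemma run_prod_flow j k i :
  sderiv i (run_prod F j k) =
  aux_rhs (ell i) (run_prod F j k) (run_prod F j M) (run_prod F (j + k) M).
Proof.
have fF l : row_finite (F l) by apply: row_finite_factor.
have fT l m : row_finite (run_prod F l m) by apply: row_finite_run_prod.
have fP l : row_finite (spos (sexp (run_prod F l M) (ell i))).
  by apply/row_finite_spos/row_finite_sexp.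
rewrite /aux_rhs; elim: k j => [|k IHk] j.
  apply: smx_ext => n m; rewrite addn0 /ssub [run_prod F j 0]/= smul1r // smul1l.
  rewrite subrr /sderiv /run_prod /= /smx1; case: eqP => _; last exact: raddf0.
  exact: fps_deriv1.
apply: smx_ext => n m; rewrite -[run_prod F j k.+1]/(smul (F j) (run_prod F j.+1 k)).
rewrite sderiv_smul // factor_flow IHk /aux_rhs smulBl ?smulBr //; last 2 first.
- exact: row_finite_smul.
- exact: row_finite_smul.
rewrite /ssub addSnnS !smulA // ?addrA ?subrK //; exact: row_finite_smul.
Qed.

Lemma cyclic_flow j : toda_flow ell (run_prod F j M).
Proof.
by move=> i; rewrite run_prod_flow (@eq_run_prod _ _ _ _ (j + M) j) ?modnDr.
Qed.

End Flows.

(** * Eigenvector arrays of polynomials *)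

Section EigenArrays.
Variables (R : realFieldType) (N s : nat).
Local Notation K := (fps R N).
Implicit Types (T X Y : smx K) (B : parray R N s).

Lemma leading_band_row_finite T d : leading_band T d -> row_finite T.
Proof.
move=> Td; apply: (@row_finite_bound _ _ (fun n => (n + d).+1)) => n m.
exact: (proj2 (Td n)).
Qed.

(** The leading 1 makes the eigenvalue equation a recurrence of order s. *)
Lemma eigen_rec T B n : leading_band T s -> eigen_array T B ->
  B (n + s)%N = 'X *: B n - \sum_(k < n + s) (T n k)%:P *: B k.
Proof.
move=> Td; have Tb : row_bound T (fun n => (n + s).+1).
  by move=> k m /(proj2 (Td k)).
move=> /(congr1 (fun A => A n)) <-.
rewrite (actE Tb _ (leqnn _)) big_ord_recr /= (proj1 (Td n)) scale1r.
by rewrite addrAC subrr add0r.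
Qed.

Lemma eigen_mulmx T B t (W : 'M[{poly K}]_(s, t)) : row_finite T ->
  eigen_array T B -> eigen_array T (fun n => B n *m W).
Proof.
move=> fT TB; rewrite /eigen_array act_mulmx // TB.
by apply/funext => n; rewrite scalemxAl.
Qed.

End EigenArrays.

Section Independence.
Variables (R : realFieldType) (N s : nat).
Local Notation K := (fps R N).
Hypothesis s_gt0 : (0 < s)%N.
Implicit Types (T X Y : smx K) (B : parray R N s).

Lemma eigen_array_inj T B B' : leading_band T s ->
  eigen_array T B -> eigen_array T B' ->
  (forall i : 'I_s, B i = B' i) -> B = B'.
Proof.
move=> Td TB TB' BB'; apply/funext => n.
elim/ltn_ind: n => n IHn; have [ns|sn] := ltnP n s.
  exact: (BB' (Ordinal ns)).
rewrite -(subnK sn) !(eigen_rec _ Td) // IHn; last by lia.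
congr (_ - _); apply: eq_bigr => k _; rewrite IHn //.
by apply: leq_trans (ltn_ord k) _; rewrite subnK.
Qed.

(** Coordinates in the basis 'X^k e_j, numbered by s * k + j: in the numbering
    adapted to the recurrence, multiplication by 'X shifts by s. *)
Definition row_coord (v : 'rV[{poly K}]_s) m : K :=
  (v 0 (Ordinal (ltn_pmod m s_gt0)))`_(m %/ s).

Lemma row_coordD v w m : row_coord (v + w) m = row_coord v m + row_coord w m.
Proof. by rewrite /row_coord mxE coefD. Qed.

Lemma row_coordN v m : row_coord (- v) m = - row_coord v m.
Proof. by rewrite /row_coord mxE coefN. Qed.

Lemma row_coord_sum n (x : 'I_n -> K) (v : 'I_n -> 'rV[{poly K}]_s) m :
  row_coord (\sum_(k < n) (x k)%:P *: v k) m =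
  \sum_(k < n) x k * row_coord (v k) m.
Proof.
rewrite /row_coord summxE coef_sum; apply: eq_bigr => k _.
by rewrite mxE coefCM.
Qed.

Lemma row_coordX v m : row_coord ('X *: v) (m + s) = row_coord v m.
Proof.
rewrite /row_coord mxE mulrC coefMX divnDr // divnn s_gt0 addn1 /=.
by congr (fun_of_matrix v _ _)`_ _; apply: val_inj; rewrite /= modnDr.
Qed.

Lemma row_coord_delta n m (i : 'I_s) : i = n :> nat -> (n <= m)%N ->
  row_coord (delta_mx 0 i) m = (m == n)%:R.
Proof.
move=> <- im; rewrite /row_coord mxE eqxx /= -val_eqE /=.
have [ms|sm] := ltnP m s.
  by rewrite modn_small // divn_small // -polyC_natr coefC.
rewrite [m == i]gtn_eqF; last exact: leq_trans (ltn_ord i) sm.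
by rewrite -polyC_natr coefC eqn0Ngt divn_gt0 // sm.
Qed.

(** Up to its initial matrix, an eigenvector array is unitriangular in these
    coordinates, so its rows are linearly independent over K. *)
Lemma right_array_inj T B X Y : leading_band T s -> right_array T B ->
  row_finite X -> row_finite Y -> act X B = act Y B -> X = Y.
Proof.
move=> Td [TB [C [_ uC BC]]] fX fY XY.
pose b : parray R N s := gauge_arr B (invmx C).
have Tb : eigen_array T b.
  by apply: eigen_mulmx => //; apply: leading_band_row_finite Td.
have bi (i : 'I_s) : b i = delta_mx 0 i.
  rewrite /b /gauge_arr BC /liftC -row_mul -map_mxM mulmxV // map_mx1.
  by rewrite row1.
have tri n m : (n <= m)%N -> row_coord (b n) m = (m == n)%:R.
  elim/ltn_ind: n m => n IHn m nm; have [ns|sn] := ltnP n s.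
    by rewrite (bi (Ordinal ns)) (@row_coord_delta n).
  have sm := leq_trans sn nm.
  rewrite -(subnK sn) (eigen_rec _ Td Tb) row_coordD row_coordN row_coord_sum.
  rewrite big1 => [|k _]; last first.
    have kn : (k < n)%N by rewrite -{2}(subnK sn).
    by rewrite IHn ?(gtn_eqF (leq_trans kn nm)) ?mulr0 // ltnW // (leq_trans kn).
  rewrite subr0 -{1}(subnK sm) row_coordX IHn ?leq_sub2r //; last by lia.
  by rewrite subnK //; congr (nat_of_bool _)%:R; lia.
(* The difference Z annihilates b. Its rows have finite support: the coordinate
   d of Z b isolates the last entry Z n d, and one descends on d. *)
pose Z := ssub X Y.
have fZ : row_finite Z by apply: row_finite_ssub.
have Zb : act Z b = fun _ => 0.
  rewrite /b /gauge_arr act_mulmx // act_ssub // XY.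
  by apply/funext => n; rewrite subrr mul0mx.
suff Z0 n : forall k, Z n k = 0.
  by apply: smx_ext => n k; apply/eqP; rewrite -subr_eq0; apply/eqP/Z0.
have /row_finiteP[beta Zbeta] := fZ.
have : forall k, (beta n <= k)%N -> Z n k = 0 by apply: Zbeta.
elim: (beta n) => [|d IHd] Zd; first by move=> m; apply: Zd.
apply: IHd => m; rewrite leq_eqVlt => /orP[/eqP<-|/Zd //].
have := congr1 (fun A : parray R N s => row_coord (A n) d) Zb.
rewrite /= /act (fsum_nat_bound (b := d.+1)) => [|j /Zd ->]; last exact: scale0r.
rewrite (row_coord_sum (fun k => Z n k) (fun k => b k)) big_ord_recr /=.
rewrite tri // eqxx mulr1 big1 => [|k _]; last first.
  by rewrite tri ?(gtn_eqF (ltn_ord k)) ?mulr0 // ltnW.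
by rewrite add0r /row_coord mxE coef0.
Qed.

End Independence.

(** * Christoffel connections *)

Section Connections.
Variables (R : realFieldType) (N s : nat) (ell : 'I_N -> nat).
Local Notation K := (fps R N).
Hypothesis s_gt0 : (0 < s)%N.
Variables (F T1 T0 : smx K).
Hypotheses (fF : row_finite F) (T1s : leading_band T1 s).
Hypotheses (T0s : leading_band T0 s) (TF : smul T1 F = smul F T0).
Local Notation parray := (parray R N).

Let fT1 : row_finite T1. Proof. exact: leading_band_row_finite T1s. Qed.
Let fT0 : row_finite T0. Proof. exact: leading_band_row_finite T0s. Qed.
Let fE1 l : row_finite (sexp T1 l). Proof. exact: row_finite_sexp. Qed.
Let fE0 l : row_finite (sexp T0 l). Proof. exact: row_finite_sexp. Qed.
Let fP1 l : row_finite (spos (sexp T1 l)). Proof. exact: row_finite_spos. Qed.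
Let fP0 l : row_finite (spos (sexp T0 l)). Proof. exact: row_finite_spos. Qed.

Lemma row_finite_aux_rhs l : row_finite (aux_rhs l F T1 T0).
Proof. by apply: row_finite_ssub; apply: row_finite_smul. Qed.

(** T1 ^ l F = F T0 ^ l turns the upper triangular parts of the auxiliary
    equation into the lower triangular parts of the Sato equations. *)
Lemma act_aux_rhs l t (B : parray t) n :
  act (aux_rhs l F T1 T0) B n + act F (sato_rhs l T0 B) n =
  sato_rhs l T1 (act F B) n.
Proof.
rewrite /sato_rhs /aux_rhs act_opp // act_ssub ?act_smul //;
  try exact: row_finite_smul.
rewrite /sneg !act_ssub //.
rewrite act_add // act_opp // -!act_smul //.
rewrite -(sexp_intertwine l fT1 fT0 fF TF).
by rewrite !opprB addrA subrK.
Qed.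

Lemma sato_rhs_mulmx l T t u (B : parray t) (W : 'M[{poly K}]_(t, u)) n :
  row_finite T -> sato_rhs l T (fun n => B n *m W) n = sato_rhs l T B n *m W.
Proof.
move=> fT; rewrite /sato_rhs act_mulmx ?mulNmx //.
exact/row_finite_sneg/row_finite_sexp.
Qed.

(** The Leibniz rule for F B0 = B1 W with Sato derivatives of B1 and B0 says that
    X and the auxiliary right-hand side act alike on B0, whose rows are
    independent. *)
Lemma cross_compatible_iff l (B1 B0 : parray s) W X :
  right_array T0 B0 -> connection F B1 B0 W -> row_finite X ->
  cross_compatible F X B1 (sato_rhs l T1 B1) B0 (sato_rhs l T0 B0) W 0
  <-> X = aux_rhs l F T1 T0.
Proof.
move=> rB0 cW fX; have fA := row_finite_aux_rhs l.
have rhsE n : sato_rhs l T1 B1 n *m W + B1 n *m 0 =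
    act (aux_rhs l F T1 T0) B0 n + act F (sato_rhs l T0 B0) n.
  by rewrite mulmx0 addr0 -sato_rhs_mulmx // act_aux_rhs cW.
split=> [XB0|-> n]; last by rewrite rhsE.
apply: (right_array_inj s_gt0 T0s rB0) => //; apply/funext => n.
by have := XB0 n; rewrite rhsE => /addIr.
Qed.

Hypothesis dF : forall i, sderiv i F = aux_rhs (ell i) F T1 T0.

Lemma eigen_act t (B : parray t) : eigen_array T0 B -> eigen_array T1 (act F B).
Proof.
by move=> TB; rewrite /eigen_array -act_smul // TF act_smul // TB act_scale.
Qed.

(** The Leibniz rule for F B, where the auxiliary equation replaces dF. *)
Lemma sato_act t (B : parray t) : sato ell T0 B -> sato ell T1 (act F B).
Proof.
move=> sB i n; rewrite mxderiv_act // dF -act_aux_rhs; congr (_ + _).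
by congr (act F _ n); apply/funext => k; apply: sB.
Qed.

(** W is fixed by the first s rows; the Sato equations of B1 and of F B0 = B1 W
    then leave B1 dW = 0, so W does not depend on the times. *)
Lemma connection_exists (B1 B0 : parray s) :
  right_array T1 B1 -> eigen_array T0 B0 -> sato ell T1 B1 -> sato ell T0 B0 ->
  exists W, connection F B1 B0 (const_pmx N W).
Proof.
move=> [TB1 [C [_ uC BC]]] TB0 sB1 sB0.
pose G := \matrix_(i < s) act F B0 i.
pose W := liftC (invmx C) *m G.
have B1M (V : 'M[{poly K}]_s) (i : 'I_s) : B1 i *m V = row i (liftC C *m V).
  by rewrite BC row_mul.
have CVC : liftC C *m liftC (invmx C) = 1%:M.
  by rewrite /liftC -map_mxM mulmxV // map_mx1.
have VCC : liftC (invmx C) *m liftC C = 1%:M.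
  by rewrite /liftC -map_mxM mulVmx // map_mx1.
have cW : connection F B1 B0 W.
  apply: (eigen_array_inj s_gt0 T1s); first exact: eigen_act.
    exact: eigen_mulmx.
  by move=> i; rewrite B1M mulmxA CVC mul1mx rowK.
suff /mxderiv_eq0_const[W0 WE] : forall i, mxderiv i W = 0.
  by exists W0; rewrite -WE.
move=> i; rewrite -[mxderiv i W]mul1mx -VCC -mulmxA.
suff -> : liftC C *m mxderiv i W = 0 by rewrite mulmx0.
apply/row_matrixP => j; rewrite -B1M row0.
have := sato_act sB0 i j; rewrite cW mxderivM sB1 sato_rhs_mulmx //.
by rewrite -[RHS]addr0 => /addrI.
Qed.

End Connections.

(** * Changes of gauge *)

Section Gauge.
Variables (R : realFieldType) (N s : nat).
Local Notation K := (fps R N).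
Local Notation parray := (parray R N).
Implicit Types (C D : 'M[K]_s).

Lemma is_trig_mulmx C D : is_trig_mx C -> is_trig_mx D -> is_trig_mx (C *m D).
Proof.
move=> /is_trig_mxP tC /is_trig_mxP tD; apply/is_trig_mxP => i j ij.
rewrite mxE big1 // => k _; have [ik|ki] := ltnP i k; first by rewrite tC ?mul0r.
by rewrite tD ?mulr0 //; apply: leq_ltn_trans ij.
Qed.

Lemma liftCM C D : liftC (C *m D) = liftC C *m liftC D.
Proof. exact: map_mxM. Qed.

Lemma liftCV C : C \in unitmx -> liftC C *m liftC (invmx C) = 1%:M.
Proof. by move=> uC; rewrite -liftCM mulmxV // /liftC map_mx1. Qed.

Lemma right_array_gauge T (B : parray s) C : row_finite T ->
  is_trig_mx C -> C \in unitmx -> right_array T B ->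
  right_array T (gauge_arr B C).
Proof.
move=> fT tC uC [TB [D [tD uD BD]]]; split; first exact: eigen_mulmx.
exists (D *m C); split; first exact: is_trig_mulmx.
  by rewrite unitmx_mul uD.
by move=> i; rewrite /gauge_arr BD -row_mul liftCM.
Qed.

Lemma connection_gauge F (B1 B0 : parray s) W C1 C0 : row_finite F ->
  C1 \in unitmx -> connection F B1 B0 W ->
  connection F (gauge_arr B1 C1) (gauge_arr B0 C0) (gauge_conn W C1 C0).
Proof.
move=> fF uC1 cW; rewrite /connection /gauge_arr act_mulmx // cW.
apply/funext => n; rewrite /gauge_conn -!mulmxA (mulmxA (liftC C1)).
by rewrite liftCV // mul1mx.
Qed.

Lemma gauge_termK i C : C \in unitmx ->
  liftC C *m liftC (gauge_term i C) = mxderiv i (liftC C).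
Proof.
by move=> uC; rewrite mxderiv_liftC /gauge_term -liftCM mulmxA mulmxV // mul1mx.
Qed.

(** Differentiate C C^-1 = 1. *)
Lemma mxderiv_liftCV i C : C \in unitmx ->
  mxderiv i (liftC (invmx C)) = - (liftC (gauge_term i C) *m liftC (invmx C)).
Proof.
move=> uC; have := congr1 (mxderiv i) (liftCV uC).
rewrite mxderivM -gauge_termK //.
have -> : mxderiv i (1%:M : 'M[{poly K}]_s) = 0.
  rewrite -(map_mx1 (@polyC K)) -/(liftC _) mxderiv_liftC.
  apply/matrixP => j k; rewrite !mxE -[(_ == _)%:R]/(_%:R : K).
  by case: eqP => _; rewrite ?fps_deriv1 ?raddf0.
move=> /eqP; rewrite addr_eq0 -mulmxA => /eqP/(congr1 (mulmx (liftC (invmx C)))).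
have VC : liftC (invmx C) *m liftC C = 1%:M.
  by rewrite -liftCM mulVmx // /liftC map_mx1.
by rewrite mulmxN !mulmxA VC !mul1mx => ->; rewrite opprK.
Qed.

Lemma mxderiv_gauge_arr (ell : 'I_N -> nat) i n T (B : parray s) C :
  row_finite T -> C \in unitmx -> sato ell T B ->
  mxderiv i (gauge_arr B C n) =
  gauged_rhs (ell i) T (gauge_arr B C) (gauge_term i C) n.
Proof.
move=> fT uC sB; rewrite /gauge_arr mxderivM sB /gauged_rhs sato_rhs_mulmx //.
by rewrite -mulmxA gauge_termK.
Qed.

Lemma mxderiv_gauge_conn i (W : 'M[{poly K}]_s) C1 C0 :
  C1 \in unitmx -> C0 \in unitmx -> mxderiv i W = 0 ->
  mxderiv i (gauge_conn W C1 C0) =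
  gauge_conn W C1 C0 *m liftC (gauge_term i C0)
  - liftC (gauge_term i C1) *m gauge_conn W C1 C0.
Proof.
move=> uC1 uC0 dW; rewrite /gauge_conn !mxderivM dW mulmx0 addr0.
rewrite mxderiv_liftCV // -(gauge_termK _ uC0) addrC !mulmxA !mulNmx.
by [].
Qed.

(** The gauge terms of B1 and of the connection cancel, and those of B0 act on
    the right of F B0 = B1 W, so both sides of the Leibniz rule gain the same
    term. *)
Lemma cross_compatible_gauged l F X T1 T0 (B1 B0 : parray s) W G1 G0 :
  row_finite F -> connection F B1 B0 W ->
  cross_compatible F X B1 (gauged_rhs l T1 B1 G1) B0 (gauged_rhs l T0 B0 G0) W
    (W *m liftC G0 - liftC G1 *m W) <->
  cross_compatible F X B1 (sato_rhs l T1 B1) B0 (sato_rhs l T0 B0) W 0.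
Proof.
move=> fF cW.
have E n : act F (gauged_rhs l T0 B0 G0) n =
    act F (sato_rhs l T0 B0) n + B1 n *m W *m liftC G0.
  by rewrite /gauged_rhs act_add // act_mulmx // cW.
split=> h n; move: (h n);
  rewrite E /gauged_rhs mulmxDl mulmxBr mulmx0 addr0 !mulmxA.
  by rewrite addrA addrACA subrr addr0 => /addIr.
by move=> hn; rewrite addrA hn [RHS]addrA [RHS]addrAC addrK.
Qed.

End Gauge.

Theorem theorem9p5 (R : realFieldType) (p q : nat)
    (hp : (1 <= p)%N) (hq : (1 <= q)%N) (hpq : coprime p q)
    (L U : nat -> smx R)
    (hL : forall k, (1 <= k <= p)%N -> normalized_positive Lo (L k))
    (hU : forall b, (1 <= b <= q)%N -> normalized_positive Up (U b))
    (a : nat) (ha : in_A_cyc p q a)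
    (Ft : seq (smx R))
    (hFt : swaps (rot a.-1 (factor_list p q L U)) Ft)
    (hword : has_type_word (sigma_min p q) Ft)
    (N : nat) (ell : 'I_N -> nat) (ell_inj : injective ell)
    (ell_pos : forall i, (1 <= ell i)%N)
    (c : nat -> fps R N)
    (hc : lax_solution ell p q (coef_of_factors p q Ft) c) :
  let M := (p + q)%N in
  let H := dop_smx (lax_op p q c) in
  let F := fun r : 'I_M => factor_of_coef p q c r in
  let T := fun r : 'I_M => cyclic_prod p q c r in
  [/\ (* the cyclic Toda equations *)
      forall r, toda_flow ell (T r),
      (* the auxiliary equations and their orientation *)
      forall r,
        smul (T r) (F r) = smul (F r) (T (ordS r)) /\
        forall i, sderiv i (F r) = aux_rhs (ell i) (F r) (T r) (T (ordS r)),
      (* H is a common integrable M-th root; in factor-copy order *)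
      [/\ root_flow ell M H,
          forall (j j' : 'I_M) n n',
            H (height p q j n) (height p q j' n') =
            if j' == ordS j then F j n n' else 0
        & forall (j j' : 'I_M) n n',
            sexp H M (height p q j n) (height p q j' n') =
            if j' == j then T j n n' else 0]
    & (* Christoffel connections in Sato-compatible normalizations *)
      forall (r : 'I_M) (B1 B0 : parray R N q),
        right_array (T r) B1 -> right_array (T (ordS r)) B0 ->
        sato ell (T r) B1 -> sato ell (T (ordS r)) B0 ->
        [/\ baecklund ell (F r) (T r) (T (ordS r)),
            exists W, connection (F r) B1 B0 (const_pmx N W)
          & forall W, connection (F r) B1 B0 (const_pmx N W) ->
            (forall i (X : smx (fps R N)), row_finite X ->
               cross_compatible (F r) X
                 B1 (sato_rhs (ell i) (T r) B1)
                 B0 (sato_rhs (ell i) (T (ordS r)) B0)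
                 (const_pmx N W) 0
               <-> X = aux_rhs (ell i) (F r) (T r) (T (ordS r))) /\
            (* time-dependent changes of the initial-condition gauges *)
            forall C1 C0 : 'M[fps R N]_q,
              is_trig_mx C1 -> C1 \in unitmx ->
              is_trig_mx C0 -> C0 \in unitmx ->
              let B1' := gauge_arr B1 C1 in
              let B0' := gauge_arr B0 C0 in
              let W' := gauge_conn (const_pmx N W) C1 C0 in
              let dW' := fun i => W' *m liftC (gauge_term i C0)
                                  - liftC (gauge_term i C1) *m W' in
              [/\ right_array (T r) B1' /\ right_array (T (ordS r)) B0',
                  connection (F r) B1' B0' W',
                  forall i n,
                    mxderiv i (B1' n) =
                      gauged_rhs (ell i) (T r) B1' (gauge_term i C1) n /\
                    mxderiv i (B0' n) =
                      gauged_rhs (ell i) (T (ordS r)) B0' (gauge_term i C0) n,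
                  forall i, mxderiv i W' = dW' i
                & forall i (X : smx (fps R N)), row_finite X ->
                    cross_compatible (F r) X
                      B1' (gauged_rhs (ell i) (T r) B1' (gauge_term i C1))
                      B0' (gauged_rhs (ell i) (T (ordS r)) B0'
                             (gauge_term i C0))
                      W' (dW' i)
                    <-> X = aux_rhs (ell i) (F r) (T r) (T (ordS r))]]].
Proof.
move=> M H F T.
have fF j : row_finite (factor_of_coef p q c j) by apply: row_finite_factor.
have TE r : T r = run_prod (factor_of_coef p q c) r M.
  by rewrite /T cyclic_prodE // ltnW.
have TSE r : T (ordS r) = run_prod (factor_of_coef p q c) r.+1 M.
  by rewrite TE; apply: eq_run_prod; rewrite modn_mod.
have toda r : toda_flow ell (T r) by rewrite TE; apply: (cyclic_flow hp hq hc).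
have orient r : smul (T r) (F r) = smul (F r) (T (ordS r)).
  by rewrite TE TSE; apply: cyclic_intertwine.
have aux r i : sderiv i (F r) = aux_rhs (ell i) (F r) (T r) (T (ordS r)).
  by rewrite TE TSE; apply: (factor_flow hp hq hc).
have Tq r : leading_band (T r) q by rewrite TE; apply: leading_band_cyclic.
split=> //.
  split; first exact: lax_root_flow hc.
    move=> j j' n n'; rewrite /H lax_block // -val_eqE /=.
    by rewrite (modn_small (ltn_ord j')).
  move=> j j' n n'; rewrite /H lax_exp_block // -TE -val_eqE.
  by rewrite !modn_small.
move=> r B1 B0 rB1 rB0 sB1 sB0.
have fT k : row_finite (T k) by apply: leading_band_row_finite (Tq k).
split.
- split=> // s B eB sB; split; first
    exact: (eigen_act (fF r) (Tq r) (Tq (ordS r)) (orient r) eB).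
  exact: (sato_act (fF r) (Tq r) (Tq (ordS r)) (orient r) (aux r) sB).
- exact: (connection_exists hq (fF r) (Tq r) (Tq (ordS r)) (orient r) (aux r)
    rB1 (proj1 rB0) sB1 sB0).
move=> W cW; split=> [i X fX|C1 C0 tC1 uC1 tC0 uC0 B1' B0' W' dW'].
  exact: (cross_compatible_iff hq (fF r) (Tq r) (Tq (ordS r)) (orient r) _
    rB0 cW fX).
have rB0' : right_array (T (ordS r)) B0'.
  exact: right_array_gauge (fT _) tC0 uC0 rB0.
have cW' : connection (F r) B1' B0' W'.
  exact: connection_gauge (fF r) uC1 cW.
split=> //; first by split=> //; apply: right_array_gauge (fT _) tC1 uC1 rB1.
- by move=> i n; split; apply: mxderiv_gauge_arr.
- by move=> i; apply: mxderiv_gauge_conn => //; apply: mxderiv_const.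
move=> i X fX; rewrite cross_compatible_gauged //; last exact: fF.
exact: (cross_compatible_iff hq (fF r) (Tq r) (Tq (ordS r)) (orient r) _
    rB0' cW' fX).
Qed.
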